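(* Let $p\ge1$, $m\ge2$, let $\xi_1<\dots<\xi_m$ be real numbers, let $r_2,\dots,r_{m-1}\in\{1,\dots,p\}$ and $r_1=r_m=p+1$, and let $\Xi$ and the B-spline space $\mathcal{S}_p^{\boldsymbol{k}}(\Xi)$ be as defined in the context. Then the Hermite interpolation operator $\pi_p^{\boldsymbol{k}}$ is well-defined: for every sufficiently smooth function $u$ on $[\xi_1,\xi_m]$ (i.e. $u$ is $C^{p-1}$ up to the endpoints on each $[\xi_j,\xi_{j+1}]$, in the sense of one-sided limits at the knots, and is $C^{p-r_j}$ across each interior knot $\xi_j$), there exists exactly one $\pi_p^{\boldsymbol{k}}u\in\mathcal{S}_p^{\boldsymbol{k}}(\Xi)$ such that, for each $2\le j\le m-1$, $$(\pi_p^{\boldsymbol{k}}u)^{(l)}(\xi_j)=u^{(l)}(\xi_j),\qquad l=0,1,\dots,p-r_j,$$ $$(\pi_p^{\boldsymbol{k}}u)^{(l)}(\xi_j^-)=u^{(l)}(\xi_j^-),\quad (\pi_p^{\boldsymbol{k}}u)^{(l)}(\xi_j^+)=u^{(l)}(\xi_j^+),\qquad l=p-r_j+1,\dots,p-1,$$ and, at the end knots, $$(\pi_p^{\boldsymbol{k}}u)^{(l)}(\xi_1^+)=u^{(l)}(\xi_1^+),\quad (\pi_p^{\boldsymbol{k}}u)^{(l)}(\xi_m^-)=u^{(l)}(\xi_m^-),\qquad l=0,1,\dots,p-1.$$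
   Context: $f^{(l)}(\xi^-)$ and $f^{(l)}(\xi^+)$ denote the $l$-th left-hand and right-hand derivatives of $f$ at $\xi$. Knot vector. For $1\le j\le m-1$ let $\xi_{j,s}=\xi_j+\frac{s}{p}(\xi_{j+1}-\xi_j)$, $s=0,\dots,p$. The knot vector $\Xi$ is the nondecreasing sequence $$\Xi=\{r_1\xi_1,\xi_{1,1},\dots,\xi_{1,p-1},r_2\xi_2,\dots,r_{m-1}\xi_{m-1},\xi_{m-1,1},\dots,\xi_{m-1,p-1},r_m\xi_m\},$$ where $r\xi$ means that $\xi$ is repeated $r$ times. B-splines and the space. Given $p+2$ knots $\tau_1\le\dots\le\tau_{p+2}$ (not all equal), the B-spline of degree $p$ with these knots is $N_{1,p}$, where $N_{a,0}(x)=1$ for $\tau_a\le x<\tau_{a+1}$ and $0$ otherwise ($1\le a\le p+1$), and $$N_{a,q}(x)=\frac{x-\tau_a}{\tau_{a+q}-\tau_a}N_{a,q-1}(x)+\frac{\tau_{a+q+1}-x}{\tau_{a+q+1}-\tau_{a+1}}N_{a+1,q-1}(x)$$ for $1\le q\le p$, $1\le a\le p+1-q$, fractions with zero denominator being $0$. $\mathcal{S}_p^{\boldsymbol{k}}(\Xi)$ is the linear span of the B-splines of degree $p$ associated with all blocks of $p+2$ consecutive knots of $\Xi$, restricted to $[\xi_1,\xi_m]$ (values at $\xi_m$ being taken as limits from the left). Here $\boldsymbol{k}=(k_1,\dots,k_m)$ with $k_j=p-r_j$; elements of the space are $C^{k_j}$ across each interior knot $\xi_j$. *)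

(* Defs.v *)
From mathcomp Require Import all_boot all_order all_algebra.
From mathcomp Require Import all_classical all_reals all_analysis.

Set Implicit Arguments.
Unset Strict Implicit.
Unset Printing Implicit Defensive.

Import Order.TTheory GRing.Theory Num.Theory.
Import numFieldNormedType.Exports.

Local Open Scope classical_set_scope.
Local Open Scope ring_scope.

(* Breakpoints and multiplicities are functions
   [xi : nat -> R] and [r : nat -> nat] of which only the values at 1, ..., m
   are used. *)

Definition left_derive (R : realType) (f : R -> R) (x : R) : R :=
  lim (h^-1 * (f (x + h) - f x) @[h --> 0^'-]).

Definition right_derive (R : realType) (f : R -> R) (x : R) : R :=
  lim (h^-1 * (f (x + h) - f x) @[h --> 0^'+]).

Definition left_deriven (R : realType) (l : nat) (f : R -> R) : R -> R :=
  iter l (@left_derive R) f.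

Definition right_deriven (R : realType) (l : nat) (f : R -> R) : R -> R :=
  iter l (@right_derive R) f.

(* f is C^n on [a, b]: f is continuous on [a, b], of class C^n on ]a, b[, and
   its derivatives up to order n have finite one-sided limits at a and b. *)
Definition Cn_closed (R : realType) (n : nat) (f : R -> R) (a b : R) : Prop :=
  [/\ {within `[a, b], continuous f},
      forall l x, (l < n)%N -> x \in `]a, b[ -> derivable (derive1n l f) x 1,
      forall x, x \in `]a, b[ -> {for x, continuous (derive1n n f)} &
      forall l, (l <= n)%N ->
        cvg (derive1n l f x @[x --> a^'+]) /\
        cvg (derive1n l f x @[x --> b^'-])].

(* f is of class C^k on a neighbourhood of x. *)
Definition Ck_across (R : realType) (k : nat) (f : R -> R) (x : R) : Prop :=
  \forall y \near x,
    (forall l, (l < k)%N -> derivable (derive1n l f) y 1) /\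
    {for y, continuous (derive1n k f)}.

(* The knots xi_(j,1), ..., xi_(j,p-1) dividing ]xi_j, xi_(j+1)[ in p equal
   parts. *)
Definition split_knots (R : realType) (p : nat) (xi : nat -> R) (j : nat) :
    seq R :=
  [seq xi j + s%:R / p%:R * (xi j.+1 - xi j) | s <- iota 1 p.-1].

Definition knot_vector (R : realType) (p m : nat) (xi : nat -> R)
    (r : nat -> nat) : seq R :=
  nseq (r 1%N) (xi 1%N) ++
  flatten [seq split_knots p xi j ++ nseq (r j.+1) (xi j.+1)
          | j <- iota 1 m.-1].

(* Cox-de Boor recursion on the knots tau 0, tau 1, ...; terms with zero
   denominator vanish because 0^-1 = 0. *)
Fixpoint cox_de_boor (R : realType) (tau : nat -> R) (q a : nat) (x : R) : R :=
  if q is q'.+1 then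
    (x - tau a) / (tau (a + q)%N - tau a) * cox_de_boor tau q' a x +
    (tau (a + q).+1 - x) / (tau (a + q).+1 - tau a.+1)
      * cox_de_boor tau q' a.+1 x
  else if tau a <= x < tau a.+1 then 1 else 0.

(* The B-spline of degree p on the block of p + 2 consecutive knots of Xi
   starting at (0-based) position i, with its value at the right end point b
   taken as the limit from the left. *)
Definition bspline (R : realType) (p : nat) (Xi : seq R) (b : R) (i : nat)
    (x : R) : R :=
  let N := cox_de_boor (fun a => nth 0 Xi (i + a)) p 0 in
  if x == b then lim (N y @[y --> b^'-]) else N x.

(* S_p^k(Xi) with k_j = p - r_j.  Functions on [xi_1, xi_m] are represented by
   their extension by 0 to R, so that equality of elements is equality on
   [xi_1, xi_m]; there are size Xi - (p + 1) blocks of p + 2 consecutive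
   knots. *)
Definition spline_space (R : realType) (p m : nat) (xi : nat -> R)
    (r : nat -> nat) : set (R -> R) :=
  let Xi := knot_vector p m xi r in
  [set s | exists c : 'I_(size Xi - p.+1) -> R,
     s = (fun x => \sum_i c i * bspline p Xi (xi m) i x)
           \_ `[xi 1%N, xi m]].

(* Main.v *)
Require Import Defs.
From mathcomp Require Import all_boot all_order all_algebra.
From mathcomp Require Import all_classical all_reals all_analysis.
From mathcomp Require Import zify ring lra.

Import Order.TTheory GRing.Theory Num.Theory.
Import numFieldNormedType.Exports.

Set Implicit Arguments.
Unset Strict Implicit.
Unset Printing Implicit Defensive.

Local Open Scope classical_set_scope.
Local Open Scope ring_scope.

(** The interpolation conditions form a square linear system in the B-spline
    coefficients, and the system is injective.

    Square: on both sides of every breakpoint the derivatives of order less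
    than [p] are prescribed, except that at an interior [xi j] the orders
    [0, ..., p - r j] are shared by the two sides.  Charge to the interval
    from [xi j] to [xi j.+1] the [p] conditions at its left end and the
    [r j.+1 - 1] unshared ones at its right end; as [r m = p + 1], these are
    all the [p] conditions at [xi m].  The total over [j] is then term by term
    the sum that counts the B-splines ([size_hermite_conds]).

    Injective: let [k] be the last index with [knot k = xi j].  Between
    [knot k] and [knot k.+1] a spline is a polynomial [P] of degree at most [p]
    in which only the coefficients [c_(k-p), ..., c_k] occur.  If the
    derivatives of [P] of order less than [p] vanish at [xi j], then
    [P = a (X - xi j)^p], and Marsden's identity
      [(X - y)^p = sum_i (prod_(j = 1..p) (knot (i + j) - y)) N_i]
    at [y = knot k] gives the B-spline coefficients of [P]: the product is [0]
    for [k - p <= i < k], so these [c_i] vanish.  In the same way the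
    conditions to the left of [xi j.+1], read on the last span before it,
    kill [c_k, ..., c_(k+p-1)], because exactly [p - 1] simple knots lie
    between the two breakpoints.  As [r j <= p], these ranges of [2 p] indices
    cover all the coefficients ([hermite_conds_free]).

    Two more facts enter, and both follow from Marsden's identity too.  The
    [p + 1] B-splines alive on a span are linearly independent there, as are
    the corresponding node products ([bpiece_free], [node_prod_free]).  And
    the two-sided derivatives in the conditions are those of the polynomial
    pieces, i.e. a spline is [C^(p - r)] at a knot of multiplicity [r]
    ([bpiece_joint]).  The last fact is proved without a derivative formula:
    the jumps of the [l]-th derivatives of the B-splines across the knot form
    a linear relation between the node products, whence they are all zero. *)

(** * Linear independence of shifted powers *)

Section PowerIndependence.
Variable F : numFieldType.

Lemma coef_XsubC_exp p b (c : F) : (b <= p)%N ->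
  (('X - c%:P) ^+ p)`_b = (- c) ^+ (p - b) *+ 'C(p, b).
Proof.
rewrite -ltnS => bp; rewrite addrC exprDn coef_sum (bigD1 (Ordinal bp)) //=.
rewrite -polyCN -rmorphXn /= coefMn coefCM coefXn eqxx mulr1 big1 ?addr0 //.
move=> i /negPf ib; rewrite coefMn -rmorphXn /= coefCM coefXn eq_sym.
by rewrite -[_ == b]/(i == Ordinal bp) ib mulr0 mul0rn.
Qed.

(** The coefficients of the powers of [X] turn a relation into a kernel vector
    of a Vandermonde matrix; the binomial factors are nonzero in
    characteristic 0. *)
Lemma shifted_powers_free p (v : nat -> F) :
  \sum_(a < p.+1) v a *: ('X - a%:R%:P) ^+ p = 0 ->
  forall a, (a <= p)%N -> v a = 0.
Proof.
move=> v0.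
pose x : 'rV[F]_p.+1 := \row_a - (a%:R).
have V_unit : Vandermonde p.+1 x \in unitmx.
  rewrite unitmxE unitfE det_Vandermonde; apply/prodf_neq0 => i _.
  apply/prodf_neq0 => j ij; rewrite !mxE opprK addrC subr_eq0 eqr_nat.
  by rewrite ltn_eqF.
have Vv : Vandermonde p.+1 x *m \col_a v a = 0.
  apply/colP => e; rewrite !mxE.
  have /(congr1 (fun P : {poly F} => P`_(p - e))) := v0.
  rewrite coef_sum coef0 => /eqP.
  under eq_bigr => a _ do
    rewrite coefZ coef_XsubC_exp ?leq_subr // subKn -1?ltnS //
            mulrnAr -mulr_natr.
  rewrite -mulr_suml mulf_eq0 pnatr_eq0 -[in X in _ || X]leqn0 leqNgt bin_gt0.
  rewrite leq_subr orbF => /eqP E.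
  by rewrite -[RHS]E; apply: eq_bigr => a _; rewrite !mxE mulrC.
have := congr1 (mulmx (invmx (Vandermonde p.+1 x))) Vv.
rewrite mulKmx // mulmx0 => /colP col0 a ap.
by have := col0 (inord a); rewrite !mxE inordK.
Qed.
End PowerIndependence.

(** * Polynomials with vanishing derivatives at a point *)

Section DerivativesAtAPoint.
Variables (F : numFieldType).

Lemma derivn_horner_dvdp (P : {poly F}) t m l : (l < m)%N ->
  ('X - t%:P) ^+ m %| P -> P^`(l).[t] = 0.
Proof.
elim: l m P => [|l IH] [|m] P //.
  rewrite exprS => _ /dvdpP[Q ->].
  by rewrite derivn0 !hornerM hornerXsubC subrr mul0r mulr0.
rewrite ltnS => lm /dvdpP[Q ->]; rewrite derivSn; apply: (IH m) => //.
rewrite derivM deriv_exp derivXsubC mul1r /=.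
apply: dvdp_add; apply: dvdp_mull; first by rewrite exprS dvdp_mull.
by rewrite -mulr_natr dvdp_mulr.
Qed.

Lemma derivn_eq0_XsubC_exp (P : {poly F}) t p : (size P <= p.+1)%N ->
  (forall l, (l < p)%N -> P^`(l).[t] = 0) ->
  exists a, P = a *: ('X - t%:P) ^+ p.
Proof.
move=> sP P0; exists P^`N(p).[t].
have comm_t : GRing.comm t%:P ('X - t%:P) by exact: mulrC.
have := nderiv_taylor_wide (p := P^:P) (n := p.+1) comm_t.
rewrite size_map_polyC => /(_ sP); rewrite addrC subrK.
rewrite -[_.['X]]/(P \Po 'X) comp_polyXr.
move=> {1}->; rewrite big_ord_recr /= big1 ?add0r => [|i _].
  by rewrite nderivn_map horner_map mul_polyC.
rewrite nderivn_map horner_map /=; have := P0 i (ltn_ord i).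
rewrite nderivn_def hornerMn => /eqP; rewrite mulrn_eq0 -leqn0 leqNgt fact_gt0 /=.
by move=> /eqP ->; rewrite mul0r.
Qed.
End DerivativesAtAPoint.

(** * The polynomial pieces of the B-splines *)

Section BSplinePieces.
Variables (F : realFieldType) (tau : nat -> F).

(** The Cox-de Boor recursion run on polynomials: the piece of the B-spline
    [N_(i,q)] on the span [tau k <= x < tau k.+1]. *)
Fixpoint bpiece (k q i : nat) : {poly F} :=
  if q is q'.+1 then
    (tau (i + q)%N - tau i)^-1 *: (('X - (tau i)%:P) * bpiece k q' i) +
    (tau (i + q).+1 - tau i.+1)^-1 *:
      (((tau (i + q).+1)%:P - 'X) * bpiece k q' i.+1)
  else (i == k)%:R.

(** The coefficient of [N_(i,q)] in Marsden's identity for [(x - y)^q]. *)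
Definition node_prod (q i : nat) (y : F) : F :=
  \prod_(j < q) (tau (i + j).+1 - y).

Lemma node_prod_recr q i y :
  node_prod q.+1 i y = node_prod q i y * (tau (i + q).+1 - y).
Proof. by rewrite /node_prod big_ord_recr. Qed.

Lemma node_prod_recl q i y :
  node_prod q.+1 i y = (tau i.+1 - y) * node_prod q i.+1 y.
Proof.
rewrite /node_prod big_ord_recl addn0; congr (_ * _).
by apply: eq_bigr => j _ /=; rewrite /bump /= addnA addn1.
Qed.

Lemma node_prod_eq0 q i j : (i < j <= i + q)%N -> node_prod q i (tau j) = 0.
Proof.
move=> /andP[ij jiq]; apply/eqP/prodf_eq0.
have lt_jq : (j - i.+1 < q)%N by lia.
exists (Ordinal lt_jq) => //=; rewrite subr_eq0; apply/eqP; congr tau; lia.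
Qed.

Lemma bpiece_gt k q i : (k < i)%N -> bpiece k q i = 0.
Proof.
elim: q i => [|q IH] i ki /=; first by rewrite gtn_eqF.
by rewrite !IH ?leqW// !mulr0 !scaler0 addr0.
Qed.

Lemma bpiece_lt k q i : (i + q < k)%N -> bpiece k q i = 0.
Proof.
elim: q i => [|q IH] i ik /=; first by rewrite ltn_eqF//; lia.
by rewrite !IH ?mulr0 ?scaler0 ?addr0//; lia.
Qed.

Hypothesis tau_ndec : {homo tau : i j / (i <= j)%N >-> i <= j}.

(** Marsden's identity on one span.  In the step from [q] to [q.+1], after a
    shift of the second half of the recursion, [bpiece k q i] gets the
    coefficient [node_prod q i y] times the affine interpolation, between
    [tau i] and [tau (i + q).+1], of the function [x - y]. *)
Lemma marsden k q n y : tau k < tau k.+1 -> (q <= k < n)%N ->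
  \sum_(i < n) node_prod q i y *: bpiece k q i = ('X - y%:P) ^+ q.
Proof.
move=> tk /andP[+ kn]; elim: q => [|q IH] qk.
  rewrite (bigD1 (Ordinal kn)) //= /node_prod big_ord0 eqxx scale1r expr0.
  rewrite big1 ?addr0// => i /negPf ik; rewrite -val_eqE /= in ik.
  by rewrite ik scaler0.
pose a i := (tau (i + q.+1)%N - tau i)^-1.
(* [G i.+1] is the second half of the recursion for [bpiece k q.+1 i]. *)
pose G i := (tau i - y) * node_prod q i y *:
  (a i *: (((tau (i + q.+1)%N)%:P - 'X) * bpiece k q i)).
transitivity (\sum_(i < n)
    (node_prod q.+1 i y *: (a i *: (('X - (tau i)%:P) * bpiece k q i)) + G i)).
  under eq_bigr => i _ do rewrite /= scalerDr.
  rewrite !big_split /=; congr (_ + _).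
  transitivity (\sum_(i < n) G i.+1).
    by apply: eq_bigr => i _; rewrite /G node_prod_recl /a !addSn !addnS.
  have := @big_ord_recl _ 0 +%R n (fun i => G i).
  rewrite big_ord_recr /= {2 3}/G bpiece_gt // bpiece_lt; last by lia.
  by rewrite !mulr0 !scaler0 add0r addr0.
rewrite exprS -IH 1?ltnW// mulr_sumr; apply: eq_bigr => i _.
have [iqk|kiq] := ltnP (i + q) k.
  by rewrite /G bpiece_lt // !(mulr0, scaler0) addr0.
have [ki|ik] := ltnP k i.
  by rewrite /G bpiece_gt // !(mulr0, scaler0) addr0.
(* The recursion divides by [0] only for B-splines that vanish on the span. *)
have d0 : tau (i + q.+1)%N - tau i != 0.
  have kiq' : (k.+1 <= i + q.+1)%N by rewrite addnS ltnS.
  by rewrite subr_eq0 gt_eqF // (le_lt_trans (tau_ndec ik))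
             // (lt_le_trans tk) // tau_ndec.
rewrite /G /a node_prod_recr addnS -!mul_polyC in d0 *.
have E : ((tau (i + q).+1 - tau i)^-1)%:P * ((tau (i + q).+1)%:P - (tau i)%:P)
  = 1 :> {poly F} by rewrite -polyCB -polyCM mulVf.
rewrite !polyCM !polyCB.
set A := (_^-1)%:P in E *; move: E; set B := bpiece _ _ _.
set t1 := (tau _)%:P; set t0 := (tau _)%:P => E.
transitivity ((A * (t1 - t0)) * ((node_prod q i y)%:P * ('X - y%:P) * B)).
  by ring.
by rewrite E; ring.
Qed.

Lemma sum_window (V : nmodType) (G : nat -> V) k p n : (p <= k < n)%N ->
  (forall i, ~~ (k - p <= i <= k)%N -> G i = 0) ->
  \sum_(i < n) G i = \sum_(e < p.+1) G (k - p + e)%N.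
Proof.
move=> /andP[pk kn] G0.
rewrite -(big_mkord xpredT G) (@big_cat_nat _ _ _ (k - p)%N) /=; [|lia|lia].
rewrite (@big_cat_nat _ _ _ k.+1 (k - p)%N) /=; [|lia|lia].
rewrite big_nat big1 => [|i /andP[_ ik]]; last by rewrite G0 //; lia.
rewrite add0r [X in _ + X]big_nat [X in _ + X]big1 ?addr0; last first.
  by move=> i /andP[ki _]; rewrite G0 //; lia.
rewrite -{1}[(k - p)%N]add0n big_addn big_mkord.
have -> : (k.+1 - (k - p))%N = p.+1 by lia.
by apply: eq_bigr => i _; rewrite addnC.
Qed.

Lemma bpiece_out k p i : ~~ (k - p <= i <= k)%N -> bpiece k p i = 0.
Proof.
rewrite negb_and -!ltnNge => /orP[ik|]; last exact: bpiece_gt.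
by apply: bpiece_lt; lia.
Qed.

(** On a single span, the [p + 1] powers [(X - a)^p], [0 <= a <= p], are free
    and are expressed through the [p + 1] pieces by the square matrix of the
    node products.  Hence that matrix is invertible, and both the pieces and
    the node products are free. *)
Section OneSpan.
Variables (k p : nat).
Hypotheses (tau_k : tau k < tau k.+1) (pk : (p <= k)%N).

Let psi := \matrix_(a < p.+1, e < p.+1) node_prod p (k - p + e) a%:R.

Let powers_via_pieces (v : 'rV[F]_p.+1) :
  \sum_(a < p.+1) v 0 a *: ('X - a%:R%:P) ^+ p =
  \sum_(e < p.+1) (v *m psi) 0 e *: bpiece k p (k - p + e).
Proof.
under eq_bigr => a _.
  rewrite -(@marsden k p k.+1) ?pk ?ltnSn //.
  rewrite (@sum_window _ (fun i => node_prod p i a%:R *: bpiece k p i) k p); last 2 first.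
  - by rewrite pk ltnSn.
  - by move=> i /bpiece_out ->; rewrite scaler0.
  rewrite scaler_sumr.
  over.
rewrite exchange_big /=; apply: eq_bigr => e _; rewrite !mxE scaler_suml.
by apply: eq_bigr => a _; rewrite mxE scalerA.
Qed.

Let powers_free (v : 'rV[F]_p.+1) :
  \sum_(a < p.+1) v 0 a *: ('X - a%:R%:P) ^+ p = 0 -> v = 0.
Proof.
move=> v0; apply/rowP => a; rewrite mxE -[a]inord_val.
apply: (@shifted_powers_free F p (fun a => v 0 (inord a))); last first.
  by rewrite -ltnS.
by rewrite -[RHS]v0; apply: eq_bigr => b _; rewrite inord_val.
Qed.

Let psi_unit : psi \in unitmx.
Proof.
rewrite -row_free_unit; apply: inj_row_free => v v0; apply: powers_free.
by rewrite powers_via_pieces v0 big1 // => e _; rewrite mxE scale0r.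
Qed.

Lemma bpiece_free n (c : nat -> F) : (k < n)%N ->
  \sum_(i < n) c i *: bpiece k p i = 0 ->
  forall i, (k - p <= i <= k)%N -> c i = 0.
Proof.
move=> kn; rewrite (@sum_window _ (fun i => c i *: bpiece k p i) k p); last 2 first.
- by rewrite pk.
- by move=> i /bpiece_out ->; rewrite scaler0.
pose w : 'rV[F]_p.+1 := \row_e c (k - p + e)%N => c0.
have : w *m invmx psi = 0.
  apply: powers_free; rewrite powers_via_pieces mulmxKV // -[RHS]c0.
  by apply: eq_bigr => e _; rewrite mxE.
move=> /(congr1 (mulmx^~ psi)); rewrite mulmxKV // mul0mx => w0 i /andP[ki ik].
have ip : (i - (k - p) < p.+1)%N by lia.
by have /rowP/(_ (Ordinal ip)) := w0; rewrite !mxE /= subnKC.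
Qed.

(** The values of the node products at the [p + 1] points [a%:R] suffice, by
    invertibility of their matrix. *)
Lemma node_prod_free n (d : nat -> F) : (k < n)%N ->
  (forall i, ~~ (k - p <= i <= k)%N -> d i = 0) ->
  (forall y, \sum_(i < n) node_prod p i y * d i = 0) ->
  forall i, d i = 0.
Proof.
move=> kn d_out d0.
have : psi *m \col_e d (k - p + e)%N = 0.
  apply/colP => a; rewrite !mxE -[RHS](d0 a%:R).
  rewrite (@sum_window _ (fun i => node_prod p i a%:R * d i) k p); last 2 first.
  - by rewrite pk.
  - by move=> i /d_out ->; rewrite mulr0.
  by apply: eq_bigr => e _; rewrite !mxE.
move=> /(congr1 (mulmx (invmx psi))); rewrite mulKmx // mulmx0 => w0 i.
have [/andP[ki ik]|] := boolP (k - p <= i <= k)%N; last exact: d_out.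
have ip : (i - (k - p) < p.+1)%N by lia.
by have /colP/(_ (Ordinal ip)) := w0; rewrite !mxE /= subnKC.
Qed.
End OneSpan.

(** If the last knot of [N_(i,q)] is [tau k.+1], then [N_(i,q)] has there a
    zero from the left whose order is [q] minus the number of its other knots
    at that point.  That number is [i + q - k], which gives the exponent. *)
Lemma dvdp_bpiece_right k q i : tau (i + q).+1 <= tau k.+1 ->
  ('X - (tau k.+1)%:P) ^+ (k - i) %| bpiece k q i.
Proof.
elim: q i => [|q IH] i le_tau /=.
  have [<-|/negPf ik] := eqVneq i k; last by rewrite dvdp0.
  by rewrite subnn expr0 dvd1p.
rewrite -!mul_polyC; apply: dvdp_add; apply: dvdp_mull.
  apply: dvdp_mull; apply: IH; apply: le_trans le_tau.
  by apply: tau_ndec; rewrite addnS.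
have [ki|ik] := leqP k i; first by rewrite (eqP ki) expr0 dvd1p.
have [lt_tau|] := ltP (tau (i + q.+1).+1) (tau k.+1).
  rewrite bpiece_lt ?mulr0 ?dvdp0 // ltnNge addSn; apply/negP => kiq.
  by move: lt_tau; rewrite ltNge tau_ndec // addnS ltnS.
move=> ge_tau; have -> : tau (i + q.+1).+1 = tau k.+1.
  by apply/eqP; rewrite eq_le le_tau.
rewrite -[_%:P - 'X]opprB mulNr dvdpNr -(subnSK ik) exprS; apply: dvdp_mul => //.
by apply: IH; rewrite addSn -addnS.
Qed.

(** The mirror image: the zero from the right of a B-spline at its first
    knot. *)
Lemma dvdp_bpiece_left k q i : tau k <= tau i ->
  ('X - (tau k)%:P) ^+ (i + q - k) %| bpiece k q i.
Proof.
elim: q i => [|q IH] i le_tau /=.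
  have [->|/negPf ik] := eqVneq i k; last by rewrite dvdp0.
  by rewrite addn0 subnn expr0 dvd1p.
rewrite -!mul_polyC; apply: dvdp_add; apply: dvdp_mull; last first.
  apply: dvdp_mull; rewrite addnS -addSn; apply: IH; apply: le_trans le_tau _.
  exact: tau_ndec.
have [iqk|kiq] := leqP (i + q.+1) k; first by rewrite (eqP iqk) expr0 dvd1p.
have [lt_tau|] := ltP (tau k) (tau i).
  rewrite bpiece_gt ?mulr0 ?dvdp0 // ltnNge; apply/negP => ik.
  by move: lt_tau; rewrite ltNge tau_ndec.
move=> ge_tau; have -> : tau i = tau k.
  by apply/eqP; rewrite eq_le le_tau ge_tau.
rewrite addnS ltnS in kiq *; rewrite subSn // exprS; apply: dvdp_mul => //.
exact: IH.
Qed.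

Lemma size_bpiece k q i : (size (bpiece k q i) <= q.+1)%N.
Proof.
have size_step n (a : F) (L P : {poly F}) : (size L <= 2)%N ->
    (size P <= n)%N -> (size (a *: (L * P)) <= n.+1)%N.
  move=> sL sP; apply: leq_trans (size_scale_leq _ _) _.
  by apply: leq_trans (size_polyMleq _ _) _; lia.
elim: q i => [|q IH] i /=; first by case: eqP; rewrite ?size_poly1 ?size_poly0.
apply: leq_trans (size_polyD _ _) _; rewrite geq_max !size_step //.
  by rewrite -opprB size_polyN size_XsubC.
by rewrite size_XsubC.
Qed.

(** The smoothness of B-splines at the point [tau k.+1 = tau k'], a knot of
    multiplicity [k' - k <= p]. *)
Section Joint.
Variables (p k k' : nat).
Hypotheses (pk : (p <= k)%N) (kk' : (k < k')%N) (k'kp : (k' <= k + p)%N).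
Hypotheses (tau_k : tau k < tau k.+1) (tau_joint : tau k.+1 = tau k')
  (tau_k' : tau k' < tau k'.+1).

(** Subtracting Marsden's identities on the two spans and differentiating [l]
    times gives the relation [sum_i node_prod p i y * d i = 0] between the
    jumps [d i].  B-splines that are alive on one side only have no jump, by
    the order of their zero, so the relation only involves the node products
    of one span, which are free. *)
Lemma bpiece_joint i l : (l <= p - (k' - k))%N ->
  (bpiece k p i)^`(l).[tau k'] = (bpiece k' p i)^`(l).[tau k'].
Proof.
move=> lp; apply/eqP; rewrite -subr_eq0; apply/eqP.
pose d i := (bpiece k p i)^`(l).[tau k'] - (bpiece k' p i)^`(l).[tau k'].
move: i; apply: (@node_prod_free k p tau_k pk k'.+1 d); first by lia.
  move=> i; rewrite negb_and -!ltnNge => /orP[ik|ki]; rewrite /d.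
    rewrite (@bpiece_lt k') ?raddf0 ?horner0 ?subr0; last by lia.
    rewrite -tau_joint; apply: (@derivn_horner_dvdp _ _ _ (k - i)); first by lia.
    by apply: dvdp_bpiece_right; rewrite tau_joint tau_ndec //; lia.
  rewrite bpiece_gt // raddf0 horner0 sub0r.
  rewrite (@derivn_horner_dvdp _ _ _ (i + p - k')) ?oppr0 //; first by lia.
  by apply: dvdp_bpiece_left; rewrite -tau_joint tau_ndec.
move=> y; under eq_bigr => i _ do rewrite /d mulrBr -!hornerZ -!derivnZ.
rewrite big_split /= sumrN -!horner_sum -!raddf_sum /=.
by rewrite !marsden ?subrr //; lia.
Qed.
End Joint.

(** A polynomial with a zero of order [p] at [tau j] is a multiple of
    [(X - tau j)^p], and in Marsden's identity at [y = tau j] the B-splines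
    that have [tau j] among their inner knots get the coefficient [0]. *)
Lemma bspline_coef_eq0 p k n (c : nat -> F) i j :
  (p <= k < n)%N -> tau k < tau k.+1 -> (k - p <= i <= k)%N ->
  (i < j <= i + p)%N ->
  (forall l, (l < p)%N -> 
     (\sum_(i < n) c i *: bpiece k p i)^`(l).[tau j] = 0) ->
  c i = 0.
Proof.
move=> pkn tau_k ik ij /derivn_eq0_XsubC_exp[|a].
  apply: leq_trans (size_sum _ _ _) _; apply/bigmax_leqP => e _.
  exact: leq_trans (size_scale_leq _ _) (size_bpiece _ _ _).
move: (pkn) => /andP[pk kn]; rewrite -(@marsden k p n (tau j) tau_k pkn).
rewrite scaler_sumr => /eqP.
rewrite -subr_eq0 -sumrB; under eq_bigr => e _ do rewrite scalerA -scalerBl.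
move=> /eqP /(@bpiece_free k p tau_k pk n
  (fun e => c e - a * node_prod p e (tau j)) kn)/(_ i ik)/eqP.
by rewrite node_prod_eq0 // mulr0 subr0 => /eqP.
Qed.

End BSplinePieces.

(** * The knot vector *)

(** The [p + 1] copies of [xi 1] have the positions [0, ..., p]; after them,
    every breakpoint is preceded by [p - 1] simple knots. *)
Definition last_copy (p : nat) (r : nat -> nat) (j : nat) : nat :=
  (p + \sum_(1 <= i < j) (p.-1 + r i.+1))%N.

Section Knots.
Variables (R : realType) (p : nat) (xi : nat -> R) (r : nat -> nat).
Hypotheses (hp : (1 <= p)%N) (hr1 : r 1%N = p.+1).

Local Notation Xi m := (knot_vector p m xi r).
Local Notation kappa := (last_copy p r).

Lemma last_copyS j : (1 <= j)%N -> kappa j.+1 = (kappa j + p.-1 + r j.+1)%N.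
Proof. by move=> j1; rewrite /last_copy big_nat_recr //= !addnA. Qed.

Lemma knot_vectorS m : (1 <= m)%N ->
  Xi m.+1 = Xi m ++ split_knots p xi m ++ nseq (r m.+1) (xi m.+1).
Proof.
case: m => // m _; rewrite /knot_vector.
have -> : iota 1 m.+2.-1 = iota 1 m.+1.-1 ++ [:: m.+1].
  by rewrite -[m.+2.-1]addn1 iotaD add1n.
by rewrite map_cat flatten_cat /= cats0 catA.
Qed.

Lemma size_knot_vector m : (1 <= m)%N -> size (Xi m) = (kappa m).+1.
Proof.
elim: m => // -[|m] IH _.
  by rewrite /knot_vector /= cats0 size_nseq hr1 /last_copy big_geq // addn0.
rewrite knot_vectorS // size_cat IH // size_cat size_map size_iota size_nseq.
by rewrite (@last_copyS m.+1) //; lia.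
Qed.

Lemma nth_knot_vector_prefix d j m i : (1 <= j <= m)%N -> (i <= kappa j)%N ->
  nth d (Xi m) i = nth d (Xi j) i.
Proof.
move=> /andP[j1 jm] ij; rewrite -(subnKC jm).
elim: (m - j)%N => [|e IH]; first by rewrite addn0.
rewrite addnS knot_vectorS ?addn_gt0 ?j1 // nth_cat.
rewrite size_knot_vector ?addn_gt0 ?j1 // ltnS IH ifT //.
apply: leq_trans ij _; rewrite /last_copy leq_add2l.
by rewrite [X in (_ <= X)%N](big_cat_nat _ (n := j)) ?leq_addr.
Qed.

Variable m : nat.
Hypotheses (hxi : forall j, (1 <= j < m)%N -> xi j < xi j.+1)
  (r_gt0 : forall j, (1 <= j <= m)%N -> (0 < r j)%N).

(** With the default value [xi m] the knots stay nondecreasing beyond the end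
    of the list. *)
Definition knot (a : nat) : R := nth (xi m) (Xi m) a.

Lemma split_knot_bounds j s : (1 <= j < m)%N -> (s <= p)%N ->
  xi j <= xi j + s%:R / p%:R * (xi j.+1 - xi j) <= xi j.+1.
Proof.
move=> /hxi; rewrite -subr_gt0 => d0 sp.
have q0 : 0 <= s%:R / p%:R :> R by rewrite divr_ge0.
have q1 : s%:R / p%:R <= 1 :> R by rewrite ler_pdivrMr ?ltr0n // mul1r ler_nat.
have := mulr_ge0 q0 (ltW d0); rewrite -subr_ge0 in q1.
by have := mulr_ge0 q1 (ltW d0); lra.
Qed.

Lemma knot_vector_sorted j : (1 <= j <= m)%N ->
  pairwise <=%R (Xi j) && all (<= xi j) (Xi j).
Proof.
elim: j => // -[|j] IH /andP[_ jm].
  rewrite /knot_vector /= cats0 all_nseq /= lexx orbT andbT.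
  by elim: (r 1%N) => //= n ->; rewrite all_nseq /= lexx orbT.
rewrite knot_vectorS // pairwise_cat.
have j_bnd : (1 <= j.+1 < m)%N by [].
have /andP[-> IH2] := IH (ltnW jm).
have split_bnd : all (fun x => xi j.+1 <= x <= xi j.+2) (split_knots p xi j.+1).
  apply/allP => x /mapP[s]; rewrite mem_iota => /andP[_ sp] ->.
  by apply: split_knot_bounds => //; lia.
have tail_bnd : all (fun x => xi j.+1 <= x <= xi j.+2)
    (split_knots p xi j.+1 ++ nseq (r j.+2) (xi j.+2)).
  by rewrite all_cat split_bnd all_nseq /= lexx (ltW (hxi j_bnd)) // orbT.
rewrite /= -andbA; apply/and3P; split; last 1 first.
- rewrite all_cat; apply/andP; split.
    by apply: sub_all IH2 => x xj /=; rewrite (le_trans xj) // ltW // hxi.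
  by apply: sub_all tail_bnd => x /andP[].
- apply/allrelP => x y xX yX.
  apply: (le_trans (allP IH2 x xX)).
  by have /andP[] := allP tail_bnd y yX.
rewrite pairwise_cat; apply/and3P; split.
- apply/allrelP => x y xX; rewrite mem_nseq => /andP[_ /eqP ->].
  by have /andP[] := allP split_bnd x xX.
- rewrite /split_knots pairwise_map; apply: (@sub_pairwise _ leq).
    move=> s t st /=; rewrite lerD2l ler_wpM2r //.
      by rewrite subr_ge0 ltW // hxi.
    by rewrite ler_pM2r ?invr_gt0 ?ltr0n // ler_nat.
  by rewrite -sorted_pairwise ?iota_sorted //; exact: leq_trans.
by elim: (r _) => //= n ->; rewrite all_nseq /= lexx orbT.
Qed.

Hypothesis m1 : (1 <= m)%N.

Lemma knot_le a : knot a <= xi m.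
Proof.
have /andP[_ /allP X_le] := @knot_vector_sorted m (introT andP (conj m1 (leqnn m))).
have [am|am] := ltnP a (size (Xi m)); last by rewrite /knot nth_default.
exact/X_le/mem_nth.
Qed.

Lemma knot_ndec : {homo knot : i j / (i <= j)%N >-> i <= j}.
Proof.
move=> a b ab.
have [bm|bm] := ltnP b (size (Xi m)); last first.
  by rewrite [leRHS]/knot nth_default // knot_le.
have /andP[X_sorted _] := @knot_vector_sorted m (introT andP (conj m1 (leqnn m))).
rewrite -sorted_pairwise in X_sorted; last exact: le_trans.
by apply: (sorted_leq_nth le_trans lexx) => //; rewrite inE (leq_ltn_trans ab).
Qed.

Lemma knot_last_copy j : (1 <= j <= m)%N -> knot (kappa j) = xi j.
Proof.
move=> jm; rewrite /knot (@nth_knot_vector_prefix _ j m _ jm) //.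
case: j jm => // -[_|j /andP[_ jm]].
  rewrite /knot_vector /= cats0 nth_nseq ifT // hr1.
  by rewrite /last_copy big_geq // addn0.
rewrite knot_vectorS // catA nth_cat size_cat size_knot_vector // size_map size_iota.
rewrite last_copyS // nth_nseq ifF; last by have := @r_gt0 j.+2 jm; lia.
by rewrite ifT //; have := @r_gt0 j.+2 jm; lia.
Qed.

(** One formula for the end points [s = 0], [s = p] and the knots between
    them. *)
Lemma knot_split j s : (1 <= j < m)%N -> (s <= p)%N ->
  knot (kappa j + s) = xi j + s%:R / p%:R * (xi j.+1 - xi j).
Proof.
move=> jm sp; have [j1 j_m] := andP jm.
have jm1 : (1 <= j.+1 <= m)%N by [].
have rj := r_gt0 jm1.
have [->|s0] := posnP s.
  by rewrite addn0 knot_last_copy ?j1 1?ltnW// !mul0r addr0.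
rewrite /knot (@nth_knot_vector_prefix _ j.+1 m _ jm1); last by rewrite last_copyS //; lia.
rewrite knot_vectorS // nth_cat size_knot_vector // ifF; last by lia.
rewrite nth_cat size_map size_iota.
have [sp1|sp1] := ltnP.
  rewrite (nth_map 0) ?size_iota // nth_iota //.
  by have -> : (1 + (kappa j + s - (kappa j).+1))%N = s by lia.
have -> : s = p by lia.
rewrite nth_nseq ifT; last by lia.
by rewrite divff ?pnatr_eq0 -?lt0n // mul1r addrC subrK.
Qed.

Lemma knot_split_lt j s : (1 <= j < m)%N -> (s < p)%N ->
  knot (kappa j + s) < knot (kappa j + s).+1.
Proof.
move=> jm sp; rewrite -addnS (@knot_split j s.+1) // (@knot_split j s jm (ltnW sp)) //.
rewrite ltrD2l ltr_pM2r.
  by rewrite ltr_pM2r ?invr_gt0 ?ltr0n // ltr_nat.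
by rewrite subr_gt0 hxi.
Qed.

Lemma knot_split_end j : (1 <= j < m)%N -> knot (kappa j + p.-1).+1 = xi j.+1.
Proof.
move=> jm; rewrite -addnS prednK // knot_split // divff ?pnatr_eq0 -?lt0n //.
by rewrite mul1r addrC subrK.
Qed.

End Knots.

(** * Derivatives of piecewise polynomial functions *)

Section PiecewisePolynomialDerivatives.
Variable R : realType.
Implicit Types (f : R -> R) (P Q : {poly R}) (a b x : R).

Lemma cvg_horner_quotient P x :
  h^-1 * (P.[x + h] - P.[x]) @[h --> 0^'] --> P^`().[x].
Proof.
have dP : derivable (horner P) x 1 by exact: derivable_horner.
have -> : P^`().[x] = 'D_1 (horner P) x by rewrite derivE derive1E.
rewrite [X in X @ _ --> _](_ : _ = fun h : R =>
  h^-1 *: ((horner P \o shift x) (h *: 1) - P.[x])) //.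
by apply/funext => h; rewrite /= [h%:A]mulr1 [h + x]addrC.
Qed.

Lemma cvg_quotient_right f P x b : x < b ->
  (forall y, x <= y < b -> f y = P.[y]) ->
  h^-1 * (f (x + h) - f x) @[h --> 0^'+] --> P^`().[x].
Proof.
move=> xb fP; apply: cvg_trans (cvg_dnbhs_at_right (@cvg_horner_quotient P x)).
apply: near_eq_cvg; near=> h.
have h0 : 0 < h by near: h; exact: nbhs_right_gt.
have hb : h < b - x by near: h; apply: nbhs_right_lt; rewrite subr_gt0.
by rewrite !fP //; lra.
Unshelve. all: by end_near. Qed.

Lemma cvg_quotient_left f P a x : a < x ->
  (forall y, a < y <= x -> f y = P.[y]) ->
  h^-1 * (f (x + h) - f x) @[h --> 0^'-] --> P^`().[x].
Proof.
move=> ax fP; apply: cvg_trans (cvg_dnbhs_at_left (@cvg_horner_quotient P x)).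
apply: near_eq_cvg; near=> h.
have h0 : h < 0 by near: h; exact: nbhs_left_lt.
have ha : a - x < h by near: h; apply: nbhs_left_gt; rewrite subr_lt0.
by rewrite !fP //; lra.
Unshelve. all: by end_near. Qed.

Lemma right_deriven_poly f P a b : (forall x, a <= x < b -> f x = P.[x]) ->
  forall l x, a <= x < b -> right_deriven l f x = P^`(l).[x].
Proof.
move=> fP; elim=> [|l IH] x; first exact: fP.
move=> /andP[ax xb]; rewrite derivnS; apply: cvg_lim => //.
apply: cvg_quotient_right xb _ => y /andP[xy yb]; apply: IH.
by rewrite (le_trans ax xy).
Qed.

Lemma left_deriven_poly f P a b : (forall x, a < x <= b -> f x = P.[x]) ->
  forall l x, a < x <= b -> left_deriven l f x = P^`(l).[x].
Proof.
move=> fP; elim=> [|l IH] x; first exact: fP.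
move=> /andP[ax xb]; rewrite derivnS; apply: cvg_lim => //.
apply: cvg_quotient_left ax _ => y /andP[ay yx]; apply: IH.
by rewrite ay (le_trans yx xb).
Qed.

Lemma derive1_joint f P Q a x b : a < x < b ->
  (forall y, a < y <= x -> f y = P.[y]) ->
  (forall y, x <= y < b -> f y = Q.[y]) ->
  P^`().[x] = Q^`().[x] -> derive1 f x = P^`().[x].
Proof.
move=> /andP[ax xb] fP fQ PQ; rewrite /derive1; apply: cvg_lim => //.
rewrite [X in X @ _ --> _](_ : _ = fun h : R => h^-1 * (f (x + h) - f x)); last first.
  by apply/funext => h; rewrite [h + x]addrC.
apply: (@cvg_at_right_left_dnbhs _ R^o).
  by rewrite PQ; exact: cvg_quotient_right fQ.
exact: cvg_quotient_left fP.
Qed.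

(** The induction on [l] needs the derivative on a neighbourhood of the joint,
    so it carries the equalities with the two polynomials on both sides. *)
Lemma derive1n_joint f P Q a x b d : a < x < b ->
  (forall y, a < y <= x -> f y = P.[y]) ->
  (forall y, x <= y < b -> f y = Q.[y]) ->
  (forall l, (l <= d)%N -> P^`(l).[x] = Q^`(l).[x]) ->
  forall l, (l <= d)%N -> derive1n l f x = Q^`(l).[x].
Proof.
move=> axb fP fQ PQ l ld.
suff [] : (forall y, a < y <= x -> derive1n l f y = P^`(l).[y]) /\
          (forall y, x <= y < b -> derive1n l f y = Q^`(l).[y]).
  by move=> _ ->; move: axb => // /andP[_ ->]; rewrite lexx.
elim: l ld => [|l IH] ld; first by split=> y; [exact: fP | exact: fQ].
have [IHP IHQ] := IH (ltnW ld); have PQ_S := PQ _ ld.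
have at_x : derive1n l.+1 f x = P^`(l.+1).[x].
  by rewrite derivnS; apply: derive1_joint IHP IHQ _; rewrite // -!derivnS.
split=> y /andP[].
  rewrite [_ <= x]le_eqVlt => ay /predU1P[->|yx] //.
  rewrite derivnS; apply: (@derive1_joint _ _ (P^`(l)) a y x) => //.
  - by rewrite ay.
  - by move=> z /andP[az zy]; apply: IHP; rewrite az (le_trans zy (ltW yx)).
  - by move=> z /andP[yz zx]; apply: IHP; rewrite (lt_le_trans ay yz) ltW.
rewrite [x <= _]le_eqVlt => /predU1P[<-|xy] yb; first by rewrite at_x PQ_S.
rewrite derivnS; apply: (@derive1_joint _ _ (Q^`(l)) x y b) => //.
- by rewrite xy.
- by move=> z /andP[xz zy]; apply: IHQ; rewrite (ltW xz) (le_lt_trans zy yb).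
- by move=> z /andP[yz zb]; apply: IHQ; rewrite zb andbT (le_trans (ltW xy) yz).
Qed.

End PiecewisePolynomialDerivatives.

(** * Square linear systems *)

Section SquareSystem.
Variable F : fieldType.

(** Coefficient families are functions on [nat], as the B-spline recursion
    shifts indices; this lemma relates them to families on ordinals. *)
Lemma extend_ord_fun N (w : 'I_N -> F) :
  exists c : nat -> F, forall i : 'I_N, c i = w i.
Proof. by exists (fun i => oapp w 0 (insub i)) => i; rewrite valK. Qed.

(** The functionals are the columns of a square matrix with trivial kernel,
    which is therefore invertible. *)
Lemma square_system (T : eqType) (N : nat) (s : seq T) (phi : T -> nat -> F) :
  size s = N ->
  (forall c : nat -> F, (forall t, t \in s -> \sum_(i < N) c i * phi t i = 0) ->
     forall i, (i < N)%N -> c i = 0) ->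
  forall v : T -> F, exists c : nat -> F,
    forall t, t \in s -> \sum_(i < N) c i * phi t i = v t.
Proof.
move=> <- phi_free v.
pose M : 'M[F]_(size s) := \matrix_(i, d) phi (tnth (in_tuple s) d) i.
have M_mul (c : nat -> F) d :
    ((\row_i c i) *m M) 0 d =
    \sum_(i < size s) c i * phi (tnth (in_tuple s) d) i.
  by rewrite mxE; apply: eq_bigr => i _; rewrite !mxE.
have M_unit : M \in unitmx.
  rewrite -row_free_unit; apply: inj_row_free => w wM.
  have [c cw] := extend_ord_fun (fun i => w 0 i).
  have w_c : \row_i c i = w by apply/rowP => i; rewrite mxE cw.
  apply/rowP => i; rewrite -w_c !mxE; apply: phi_free (ltn_ord i) => t.
  by move=> /seq_tnthP[d ->]; rewrite -M_mul w_c wM mxE.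
pose w := (\row_d v (tnth (in_tuple s) d)) *m invmx M.
have [c cw] := extend_ord_fun (fun i => w 0 i).
exists c => t /seq_tnthP[d ->]; rewrite -M_mul.
have -> : \row_i c i = w by apply/rowP => i; rewrite mxE cw.
by rewrite mulmxKV // mxE.
Qed.

End SquareSystem.

(** * From Cox-de Boor functions to their pieces *)

Section CoxDeBoor.
Variable R : realType.
Implicit Types (tau : nat -> R) (x : R).

Lemma cox_de_boor_ext tau1 tau2 q a1 a2 x :
  (forall e, (e <= q.+1)%N -> tau1 (a1 + e)%N = tau2 (a2 + e)%N) ->
  cox_de_boor tau1 q a1 x = cox_de_boor tau2 q a2 x.
Proof.
elim: q a1 a2 => [|q IH] a1 a2 eq_tau /=.
  by have := eq_tau 0%N; have := eq_tau 1%N; rewrite !addn1 !addn0 => -> // ->.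
have := eq_tau 0%N; have := eq_tau 1%N; rewrite !addn1 !addn0 => -> // -> //.
rewrite -!addnS !eq_tau // (IH a1 a2) ?(IH a1.+1 a2.+1) // => e eq.
  by rewrite !addSnnS eq_tau.
by rewrite eq_tau // ltnW.
Qed.

Lemma cox_de_boor_bpiece tau k q i x :
  {homo tau : i j / (i <= j)%N >-> i <= j} ->
  tau k <= x < tau k.+1 -> cox_de_boor tau q i x = (bpiece tau k q i).[x].
Proof.
move=> tau_ndec kx; elim: q i => [|q IH] i /=.
  have [->|ik] := eqVneq i k; first by rewrite kx hornerC.
  rewrite horner0; case: ifP => // ix; case/negP: ik; move: kx ix.
  case: ltngtP => // [ik|ki] /andP[kx xk] /andP[ix xi].
    by have := tau_ndec i.+1 k ik; lra.
  by have := tau_ndec k.+1 i ki; lra.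
by rewrite !IH !hornerE /=; congr (_ + _); ring.
Qed.
End CoxDeBoor.

(** * Splines on the given knots and their derivatives at the breakpoints *)

Section HermiteSplines.
Variables (R : realType) (p m : nat) (xi : nat -> R) (r : nat -> nat).
Hypotheses (hp : (1 <= p)%N) (hm : (2 <= m)%N)
  (hxi : forall j, (1 <= j < m)%N -> xi j < xi j.+1)
  (hr : forall j, (2 <= j < m)%N -> (1 <= r j <= p)%N)
  (hr1 : r 1%N = p.+1) (hrm : r m = p.+1).

Local Notation Xi := (knot_vector p m xi r).
Local Notation N := (size Xi - p.+1)%N.
Local Notation kappa := (last_copy p r).
Local Notation tau := (knot p xi r m).

Let r_gt0 j : (1 <= j <= m)%N -> (0 < r j)%N.
Proof.
move=> /andP[j1 jm]; have [->|j_neq1] := eqVneq j 1%N; first by rewrite hr1.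
have [->|j_neqm] := eqVneq j m; first by rewrite hrm.
have jm' : (2 <= j < m)%N by lia.
by have /andP[] := hr jm'.
Qed.

Let m1 : (1 <= m)%N := ltnW hm.
Let tau_ndec : {homo tau : i j / (i <= j)%N >-> i <= j} :=
  knot_ndec hp hr1 hxi m1.
Let tau_le a : tau a <= xi m := knot_le hp hr1 hxi m1 a.
Let tau_kappa j (jm : (1 <= j <= m)%N) : tau (kappa j) = xi j :=
  knot_last_copy xi hp hr1 r_gt0 m1 jm.
Let tau_split_lt j s (jm : (1 <= j < m)%N) (sp : (s < p)%N) :
    tau (kappa j + s) < tau (kappa j + s).+1 :=
  knot_split_lt hp hr1 hxi r_gt0 m1 jm sp.
Let tau_split_end j (jm : (1 <= j < m)%N) : tau (kappa j + p.-1).+1 = xi j.+1 :=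
  knot_split_end xi hp hr1 r_gt0 m1 jm.

Lemma nb_bsplines : N = (\sum_(1 <= j < m) (p.-1 + r j.+1))%N.
Proof. by rewrite size_knot_vector // /last_copy subSS addKn. Qed.

Let mm : (1 <= m.-1 < m)%N. Proof. by lia. Qed.

Let kappa_m : kappa m = (kappa m.-1 + p.-1 + p.+1)%N.
Proof.
by have /andP[mm1 _] := mm; rewrite -[in LHS](prednK m1) last_copyS // prednK // hrm.
Qed.

Lemma last_copy_ltn j : (1 <= j < m)%N -> (kappa j + p <= N)%N.
Proof.
move=> /andP[j1 jm]; rewrite size_knot_vector // subSS.
rewrite leq_subRL; last by rewrite /last_copy leq_addr.
rewrite kappa_m.
suff : (kappa j <= kappa m.-1)%N by lia.
rewrite /last_copy leq_add2l.
by rewrite [X in (_ <= X)%N](big_cat_nat (n := j)) ?leq_addr //; lia.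
Qed.

Lemma last_copy_ge j : (p <= kappa j)%N.
Proof. exact: leq_addr. Qed.

Definition spline (c : nat -> R) : R -> R :=
  (fun x => \sum_(i < N) c i * bspline p Xi (xi m) i x) \_ `[xi 1%N, xi m].

Definition spline_piece (c : nat -> R) (k : nat) : {poly R} :=
  \sum_(i < N) c i *: bpiece tau k p i.

Lemma horner_spline_piece c k l x : (spline_piece c k)^`(l).[x] =
  \sum_(i < N) c i * (bpiece tau k p i)^`(l).[x].
Proof.
rewrite raddf_sum horner_sum; apply: eq_bigr => i _.
by rewrite /= derivnZ hornerZ.
Qed.

Let cox_de_boor_block k (i : 'I_N) x : tau k <= x < tau k.+1 ->
  cox_de_boor (fun a => nth 0 Xi (i + a)%N) p 0 x = (bpiece tau k p i).[x].
Proof.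
move=> kx; rewrite -cox_de_boor_bpiece //; apply: cox_de_boor_ext => e ep.
by rewrite add0n /knot; apply: set_nth_default; have := ltn_ord i; lia.
Qed.

Lemma spline_span c k x : (p <= k)%N -> tau k <= x < tau k.+1 ->
  spline c x = (spline_piece c k).[x].
Proof.
move=> pk kx; have /andP[kx1 kx2] := kx.
have xm : x < xi m by exact: lt_le_trans kx2 (tau_le _).
have x1 : xi 1%N <= x.
  apply: le_trans kx1; rewrite -tau_kappa //.
  by apply: tau_ndec; rewrite /last_copy big_geq // addn0.
rewrite /spline patchE mem_set /=; last by rewrite in_itv /= x1 ltW.
rewrite -[spline_piece c k]derivn0 horner_spline_piece; apply: eq_bigr => i _.
by rewrite /bspline lt_eqF // derivn0 (cox_de_boor_block i kx).
Qed.

Let end_span : tau (kappa m.-1 + p.-1) < xi m.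
Proof.
rewrite -[X in _ < xi X](prednK m1) -tau_split_end //.
by apply: tau_split_lt => //; lia.
Qed.

Lemma spline_end c :
  spline c (xi m) = (spline_piece c (kappa m.-1 + p.-1)).[xi m].
Proof.
set k := (kappa m.-1 + p.-1)%N.
rewrite /spline patchE mem_set /=; last first.
  by rewrite in_itv /= lexx andbT -(@tau_kappa 1%N) //.
rewrite -[spline_piece c k]derivn0 horner_spline_piece; apply: eq_bigr => i _.
rewrite /bspline eqxx derivn0; congr (_ * _); apply: cvg_lim => //.
apply: cvg_trans (cvg_at_left_filter (@continuous_horner _ (bpiece tau k p i) _)).
apply: near_eq_cvg; near=> y; symmetry; apply: cox_de_boor_block.
apply/andP; split; first by apply: ltW; near: y; exact: nbhs_left_gt.
have -> : tau k.+1 = xi m.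
  by rewrite -[X in xi X](prednK m1) -tau_split_end.
by near: y; exact: nbhs_left_lt.
Unshelve. all: by end_near. Qed.

(** The span that ends at the interior breakpoint [xi j.+1] is the one of
    index [kappa j + p.-1], the span that starts there is the one of index
    [kappa j.+1]: they are [r j.+1] apart. *)
Lemma spline_piece_joint c j l : (1 <= j)%N -> (j.+1 < m)%N ->
  (l <= p - r j.+1)%N ->
  (spline_piece c (kappa j + p.-1))^`(l).[xi j.+1] =
  (spline_piece c (kappa j.+1))^`(l).[xi j.+1].
Proof.
move=> j1 jm lr; have jm1 : (1 <= j < m)%N by rewrite j1 ltnW.
have jm2 : (1 <= j.+1 < m)%N by [].
have jm3 : (1 <= j.+1 <= m)%N by lia.
have /andP[rj1 rjp] : (1 <= r j.+1 <= p)%N by apply: hr; rewrite ltnS j1.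
rewrite !horner_spline_piece; apply: eq_bigr => i _; congr (_ * _).
have E : tau (kappa j.+1) = xi j.+1 by exact: tau_kappa.
have E' := last_copyS p r j1.
rewrite -E; apply: bpiece_joint; rewrite ?E'.
- exact: tau_ndec.
- by have := last_copy_ge j; lia.
- by lia.
- by lia.
- by apply: tau_split_lt => //; lia.
- by rewrite -E' E tau_split_end.
- by rewrite -E' -[X in tau X]addn0 -[X in tau X.+1]addn0 tau_split_lt.
- by lia.
Qed.

Let spline_right c j x : (1 <= j < m)%N -> xi j <= x < tau (kappa j).+1 ->
  spline c x = (spline_piece c (kappa j)).[x].
Proof.
move=> jm jx; apply: spline_span => //; first exact: last_copy_ge.
by rewrite tau_kappa //; lia.
Qed.

Let right_span j : (1 <= j < m)%N -> xi j < tau (kappa j).+1.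
Proof.
move=> jm; have jm' : (1 <= j <= m)%N by lia.
rewrite -(tau_kappa jm').
by rewrite -[X in tau X < _]addn0 -[X in tau X.+1]addn0; apply: tau_split_lt.
Qed.

Let left_span j : (1 <= j < m)%N -> tau (kappa j + p.-1) < xi j.+1.
Proof.
move=> jm; rewrite -(tau_split_end jm).
by apply: tau_split_lt => //; lia.
Qed.

(** The right end point [xi j.+1] is included: at an interior breakpoint by
    continuity, at [xi m] by the convention on the values of B-splines. *)
Let spline_left c j x : (1 <= j < m)%N -> tau (kappa j + p.-1) < x <= xi j.+1 ->
  spline c x = (spline_piece c (kappa j + p.-1)).[x].
Proof.
move=> jm /andP[jx]; have [j1 j_m] := andP jm.
rewrite le_eqVlt => /predU1P[->|xj]; last first.
  apply: spline_span; first by have := last_copy_ge j; lia.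
  by rewrite ltW //= tau_split_end.
have [jm1|jm1] := ltnP j.+1 m; last first.
  have -> : j = m.-1 by lia.
  by rewrite prednK // spline_end.
rewrite -[spline_piece c _]derivn0 spline_piece_joint // derivn0; apply: spline_right => //.
by rewrite lexx right_span.
Qed.

Lemma right_deriven_spline c j l : (1 <= j < m)%N ->
  right_deriven l (spline c) (xi j) = (spline_piece c (kappa j))^`(l).[xi j].
Proof.
move=> jm; apply: (right_deriven_poly (a := xi j) (b := tau (kappa j).+1)).
  by move=> x; exact: spline_right.
by rewrite lexx right_span.
Qed.

Lemma left_deriven_spline c j l : (1 <= j < m)%N ->
  left_deriven l (spline c) (xi j.+1) =
  (spline_piece c (kappa j + p.-1))^`(l).[xi j.+1].
Proof.
move=> jm.
apply: (left_deriven_poly (a := tau (kappa j + p.-1)%N) (b := xi j.+1)).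
  by move=> x; exact: spline_left.
by rewrite lexx left_span.
Qed.

Lemma derive1n_spline c j l : (2 <= j < m)%N -> (l <= p - r j)%N ->
  derive1n l (spline c) (xi j) = (spline_piece c (kappa j))^`(l).[xi j].
Proof.
case: j => [|[|j]] // /andP[_ jm].
have jm1 : (1 <= j.+1 < m)%N by lia.
apply: (@derive1n_joint _ _ (spline_piece c (kappa j.+1 + p.-1)) _
  (tau (kappa j.+1 + p.-1)%N) _ (tau (kappa j.+2).+1) (p - r j.+2)%N).
- by rewrite left_span // right_span.
- by move=> x; exact: spline_left.
- by move=> x; exact: spline_right.
- by move=> l'; exact: spline_piece_joint.
Qed.

(** * Counting the interpolation conditions *)

(** A condition is coded by a triple [(on_right, j, l)]: it concerns the
    [l]-th derivative between [xi j] and [xi j.+1], at the left end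
    (to the right of [xi j]) if [on_right], else at the right end. *)
Definition cond_span (t : bool * nat * nat) : nat :=
  let: (on_right, j, _) := t in
  if on_right then kappa j else (kappa j + p.-1)%N.

Definition cond_site (t : bool * nat * nat) : R :=
  let: (on_right, j, _) := t in if on_right then xi j else xi j.+1.

(** At an interior breakpoint the two-sided conditions are coded on the right.
    On the left there remain the orders from [p - r j.+1 + 1 = p.+1 - r j.+1]
    to [p - 1]; for [j.+1 = m] the same formula gives all the orders from [0]
    to [p - 1], because [r m = p.+1]. *)
Definition hermite_conds : seq (bool * nat * nat) :=
  flatten [seq [seq (true, j, l) | l <- iota 0 p] ++
               [seq (false, j, l) | l <- iota (p.+1 - r j.+1) (r j.+1).-1]
          | j <- iota 1 m.-1].

Definition cond_functional (t : bool * nat * nat) (i : nat) : R :=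
  (bpiece tau (cond_span t) p i)^`(t.2).[cond_site t].

Lemma size_hermite_conds : size hermite_conds = N.
Proof.
rewrite nb_bsplines size_flatten /shape -map_comp sumnE big_map.
rewrite /index_iota subn1 !big_seq; apply: eq_bigr => j; rewrite mem_iota => jm.
rewrite /= size_cat !size_map !size_iota.
have := @r_gt0 j.+1; lia.
Qed.

Let r_le j : (1 <= j <= m)%N -> (r j <= p.+1)%N.
Proof.
move=> /andP[j1 jm]; have [->|j_neq1] := eqVneq j 1%N; first by rewrite hr1.
have [->|j_neqm] := eqVneq j m; first by rewrite hrm.
have jm' : (2 <= j < m)%N by lia.
by have /andP[_ /leqW] := hr jm'.
Qed.

Lemma hermite_condsP t : reflect
  (exists2 j, (1 <= j < m)%N &
     (exists2 l, (l < p)%N & t = (true, j, l)) \/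
     (exists2 l, (p.+1 - r j.+1 <= l < p)%N & t = (false, j, l)))
  (t \in hermite_conds).
Proof.
have range j l : (1 <= j < m)%N ->
    (l \in iota (p.+1 - r j.+1) (r j.+1).-1) = (p.+1 - r j.+1 <= l < p)%N.
  move=> jm; have jm' : (1 <= j.+1 <= m)%N by lia.
  by have := r_gt0 jm'; have := r_le jm'; rewrite mem_iota; lia.
apply: (iffP flatten_mapP) => [[j]|[j jm t_in]].
  rewrite mem_iota => j_in; have jm : (1 <= j < m)%N by lia.
  rewrite mem_cat => /orP[|] /mapP[l l_in ->]; exists j => //.
    by left; exists l => //; move: l_in; rewrite mem_iota.
  by right; exists l => //; rewrite -range.
exists j; first by rewrite mem_iota; lia.
rewrite mem_cat; case: t_in => -[l lp ->]; apply/orP; [left|right].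
  by apply: map_f; rewrite mem_iota.
by apply: map_f; rewrite range.
Qed.

(** The conditions on the interval from [xi j] to [xi j.+1] determine the
    coefficients [kappa j - p, ..., kappa j + p - 1]: the first [p] of them
    come from the left end point, the last [p] from the right one. *)
Lemma hermite_conds_free (c : nat -> R) :
  (forall t, t \in hermite_conds ->
     \sum_(i < N) c i * cond_functional t i = 0) ->
  forall i, (i < N)%N -> c i = 0.
Proof.
move=> c0.
have right0 j l : (1 <= j < m)%N -> (l < p)%N ->
    (spline_piece c (kappa j))^`(l).[xi j] = 0.
  move=> jm lp; rewrite horner_spline_piece; apply: (c0 (true, j, l)).
  by apply/hermite_condsP; exists j => //; left; exists l.
have left0 j l : (1 <= j < m)%N -> (l < p)%N ->
    (spline_piece c (kappa j + p.-1))^`(l).[xi j.+1] = 0.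
  move=> jm lp; have [lr|rl] := ltnP l (p.+1 - r j.+1); last first.
    rewrite horner_spline_piece; apply: (c0 (false, j, l)).
    by apply/hermite_condsP; exists j => //; right; exists l => //; rewrite rl.
  (* An order shared by the two sides is only coded on the right. *)
  have [j1 j_m] := andP jm.
  have jm1 : (j.+1 < m)%N.
    rewrite ltn_neqAle j_m andbT; apply/negP => /eqP E.
    by move: lr; rewrite E hrm subnn.
  by rewrite spline_piece_joint ?right0 //; lia.
have coef0 j i : (1 <= j < m)%N ->
    (kappa j - p <= i < kappa j + p)%N -> c i = 0.
  move=> jm /andP[ji ij]; have jN := last_copy_ltn jm.
  have pj := last_copy_ge j.
  have [ij'|ji'] := ltnP i (kappa j).
    apply: (@bspline_coef_eq0 R tau tau_ndec p (kappa j) N c i (kappa j)).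
    - by lia.
    - by rewrite -[kappa j]addn0; apply: tau_split_lt.
    - by lia.
    - by lia.
    - by move=> l lp; rewrite tau_kappa ?right0 //; lia.
  apply: (@bspline_coef_eq0 R tau tau_ndec p (kappa j + p.-1) N c i
    (kappa j + p.-1).+1).
  - by lia.
  - by apply: tau_split_lt => //; lia.
  - by lia.
  - by lia.
  - by move=> l lp; rewrite tau_split_end ?left0.
have below j : (1 <= j < m)%N -> forall i, (i < kappa j + p)%N -> c i = 0.
  elim: j => // -[_|j IH] jm i ij.
    by apply: (coef0 1%N) => //; rewrite /last_copy big_geq // in ij *; lia.
  have jm1 : (1 <= j.+1 < m)%N by lia.
  have [ij'|ji] := ltnP i (kappa j.+1 + p); first exact: IH ij'.
  apply: (coef0 j.+2) => //; rewrite ij andbT last_copyS //.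
  have /andP[_ rp] : (1 <= r j.+2 <= p)%N by exact: hr.
  by lia.
move=> i iN; apply: (below m.-1) => //.
by move: iN; rewrite size_knot_vector // kappa_m; lia.
Qed.

Definition hermite_match (s u : R -> R) : Prop :=
  (forall j, (2 <= j < m)%N ->
     (forall l, (l <= p - r j)%N ->
        derive1n l s (xi j) = derive1n l u (xi j)) /\
     (forall l, (p - r j + 1 <= l <= p.-1)%N ->
        left_deriven l s (xi j) = left_deriven l u (xi j) /\
        right_deriven l s (xi j) = right_deriven l u (xi j))) /\
  (forall l, (l <= p.-1)%N ->
     right_deriven l s (xi 1%N) = right_deriven l u (xi 1%N) /\
     left_deriven l s (xi m) = left_deriven l u (xi m)).

(** For [j = 1] the first case only occurs for [l = 0], where all notions of
    derivative are the value of [u]. *)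
Definition cond_value (u : R -> R) (t : bool * nat * nat) : R :=
  let: (on_right, j, l) := t in
  if on_right then
    if (l <= p - r j)%N then derive1n l u (xi j) else right_deriven l u (xi j)
  else left_deriven l u (xi j.+1).

Lemma hermite_match_spline c u : hermite_match (spline c) u <->
  (forall t, t \in hermite_conds ->
     \sum_(i < N) c i * cond_functional t i = cond_value u t).
Proof.
split=> [[inner outer] t /hermite_condsP[j jm] | conds].
  case=> [] [l lp ->]; rewrite -horner_spline_piece /=.
    have [j1|j_neq1] := eqVneq j 1%N.
      rewrite j1 in jm *; have lp1 : (l <= p.-1)%N by lia.
      have [end1 _] := outer l lp1.
      rewrite -right_deriven_spline // end1 hr1 subnS subnn.
      by case: l {lp lp1 end1}.
    have jm2 : (2 <= j < m)%N by lia.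
    have [two_sided one_sided] := inner j jm2.
    case: ifPn => [lr|rl]; first by rewrite -derive1n_spline ?two_sided.
    by rewrite -right_deriven_spline //; apply one_sided; lia.
  rewrite -left_deriven_spline //; have [jm1|jm1] := ltnP j.+1 m.
    have jm2 : (2 <= j.+1 < m)%N by lia.
    have rj := hr jm2.
    by have [_ one_sided] := inner _ jm2; apply one_sided; lia.
  have -> : j.+1 = m by lia.
  by apply outer; lia.
have right_eq j l : (1 <= j < m)%N -> (l < p)%N ->
    (spline_piece c (kappa j))^`(l).[xi j] = cond_value u (true, j, l).
  move=> jm lp; rewrite horner_spline_piece -conds //.
  by apply/hermite_condsP; exists j => //; left; exists l.
have left_eq j l : (1 <= j < m)%N -> (p.+1 - r j.+1 <= l < p)%N ->
    (spline_piece c (kappa j + p.-1))^`(l).[xi j.+1] =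
    left_deriven l u (xi j.+1).
  move=> jm lp; rewrite horner_spline_piece; apply: (conds (false, j, l)).
  by apply/hermite_condsP; exists j => //; right; exists l.
split=> [j jm | l lp].
  have /andP[rj1 rjp] := hr jm; have jm1 : (1 <= j < m)%N by lia.
  split=> l lp; first by rewrite derive1n_spline // right_eq /= ?lp //; lia.
  split; last first.
    by rewrite right_deriven_spline // right_eq //= ?ifN //; lia.
  case: j jm jm1 rj1 rjp lp => [|[|j]] // jm jm1 rj1 rjp lp.
  by rewrite left_deriven_spline ?left_eq //; lia.
split.
  rewrite right_deriven_spline // right_eq //=; last by lia.
  by rewrite hr1 subnS subnn; case: l {lp}.
rewrite -(prednK m1) left_deriven_spline // left_eq //.
by rewrite prednK // hrm; lia.
Qed.

Lemma spline_spaceP s :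
  spline_space p m xi r s <-> exists c : nat -> R, s = spline c.
Proof.
split=> [[w ->]|[c ->]]; last by exists (fun i : 'I_N => c i).
have [c cw] := extend_ord_fun w; exists c; congr patch.
by apply/funext => x; apply: eq_bigr => i _; rewrite cw.
Qed.

Lemma hermite_spline_exists_unique u :
  exists! s : R -> R, spline_space p m xi r s /\ hermite_match s u.
Proof.
have [c c_u] :=
  square_system size_hermite_conds hermite_conds_free (cond_value u).
exists (spline c); split.
  by split; [apply/spline_spaceP; exists c | apply/hermite_match_spline].
move=> _ [/spline_spaceP[c' ->] /hermite_match_spline c'_u].
congr patch; apply/funext => x; apply: eq_bigr => i _; congr (_ * _).
apply/eqP; rewrite -subr_eq0; apply/eqP.
apply: (hermite_conds_free (c := fun i => c i - c' i)) => // t t_in.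
under eq_bigr => e _ do rewrite mulrBl.
by rewrite sumrB c_u // c'_u // subrr.
Qed.

End HermiteSplines.
Theorem theorem3 (R : realType) (p m : nat) (xi : nat -> R) (r : nat -> nat)
    (hp : (1 <= p)%N) (hm : (2 <= m)%N)
    (hxi : forall j, (1 <= j < m)%N -> xi j < xi j.+1)
    (hr : forall j, (2 <= j < m)%N -> (1 <= r j <= p)%N)
    (hr1 : r 1%N = p.+1) (hrm : r m = p.+1)
    (u : R -> R)
    (hu : forall j, (1 <= j < m)%N -> Cn_closed p.-1 u (xi j) (xi j.+1))
    (hu' : forall j, (2 <= j < m)%N -> Ck_across (p - r j) u (xi j)) :
  exists! s : R -> R,
    [/\ spline_space p m xi r s,
        forall j, (2 <= j < m)%N ->
          (forall l, (l <= p - r j)%N ->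
             derive1n l s (xi j) = derive1n l u (xi j)) /\
          (forall l, (p - r j + 1 <= l <= p.-1)%N ->
             left_deriven l s (xi j) = left_deriven l u (xi j) /\
             right_deriven l s (xi j) = right_deriven l u (xi j)) &
        forall l, (l <= p.-1)%N ->
          right_deriven l s (xi 1%N) = right_deriven l u (xi 1%N) /\
          left_deriven l s (xi m) = left_deriven l u (xi m)].
Proof.
have [s [[s_in [s_inner s_outer]] s_unique]] :=
  hermite_spline_exists_unique hp hm hxi hr hr1 hrm u.
exists s; split=> // s' [s'_in s'_inner s'_outer].
exact: s_unique (conj s'_in (conj s'_inner s'_outer)).
Qed.
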